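(* Let $N$ be a normal subgroup of a finite group $G$. If $f\in\mathrm{cf}_G(N)$, then $f$ can be uniquely expressed in the form $$f=\sum_{\widehat{\theta}\in\mathrm{Min}_G(N)}a_{\widehat{\theta}}\,\widehat{\theta},$$ where $a_{\widehat{\theta}}\in\mathbb{C}$. Furthermore, $f$ is a $G$-invariant character of $N$ if and only if all of the $a_{\widehat{\theta}}$ are nonnegative integers and $f\neq0$.
   Context: $\mathrm{cf}_G(N)=\{f:N\to\mathbb{C}\mid f(n^g)=f(n)\text{ for all }n\in N,\ g\in G\}$ is the $\mathbb{C}$-vector space of $G$-invariant class functions of $N$. Characters are over $\mathbb{C}$. For a class function $\theta$ of $N$ and $g\in G$, $\theta^g(x)=\theta(gxg^{-1})$; $\theta$ is $G$-invariant if $\theta^g=\theta$ for all $g\in G$. For $\theta\in\mathrm{Irr}(N)$, $\widehat{\theta}$ denotes the sum of the distinct $G$-conjugates of $\theta$, and $\mathrm{Min}_G(N)=\{\widehat{\theta}\mid\theta\in\mathrm{Irr}(N)\}$ is the set of minimal $G$-invariant characters of $N$. *)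

(* Defs.v *)
From HB Require Import structures.
From mathcomp Require Import all_boot all_order all_algebra all_fingroup.
From mathcomp Require Import mxrepresentation.
From mathcomp Require Import reals.
From mathcomp Require Import complex.

Set Implicit Arguments.
Unset Strict Implicit.
Unset Printing Implicit Defensive.

Import Order.TTheory GRing.Theory Num.Theory.
Local Open Scope ring_scope.

(* The field of complex numbers is R[i] with R : realType, rather than the
   field algC of algebraic numbers underlying 'CF(G), because class functions
   and their coefficients may take transcendental values.

   A function N -> C is encoded, as in classfun, by a finite function on the
   ambient type gT that vanishes outside N. *)

Section InvariantCharacters.

Variables (R : realType) (gT : finGroupType).
Local Notation C := (R[i]).
Local Notation cfunT := {ffun gT -> C}.
Implicit Types (G N : {group gT}) (f theta : cfunT).

Definition cf_inv G N f : Prop :=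
  (forall x, x \notin N -> f x = 0) /\
  (forall n g, n \in N -> g \in G -> f (n ^ g)%g = f n).

Definition repr_char N n (rN : mx_representation C N n) : cfunT :=
  [ffun x => if x \in N then \tr (rN x) else 0].

Definition is_character N f : Prop :=
  exists n, (0 < n)%N /\
    exists rN : mx_representation C N n, f = repr_char rN.

(* For g in the normaliser of N this preserves functions supported on N. *)
Definition conj_fun theta (g : gT) : cfunT :=
  [ffun x => theta (g * x * g^-1)%g].

Definition is_inv_character G N f : Prop :=
  is_character N f /\ (forall g, g \in G -> conj_fun f g = f).

(* As for irr in character, the irreducible representations are enumerated,
   up to isomorphism, by the socle of the regular representation; see IrrP. *)
Definition Irr N : seq cfunT :=
  undup [seq repr_char (irr_repr i) | i : DecSocleType (regular_repr C N)].

Definition conjugates G theta : seq cfunT :=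
  undup [seq conj_fun theta g | g in G].

Definition hat G theta : cfunT := \sum_(chi <- conjugates G theta) chi.

Definition Min G N : seq cfunT := undup [seq hat G theta | theta <- Irr N].

Lemma repr_char_sim N n1 n2 (r1 : mx_representation C N n1)
    (r2 : mx_representation C N n2) :
  mx_rsim r1 r2 -> repr_char r1 = repr_char r2.
Proof.
by move=> sim; apply/ffunP=> x; rewrite !ffunE; case: ifP => // /(mxtrace_rsim sim).
Qed.

Lemma IrrP N theta :
  theta \in Irr N <->
  exists n (rN : mx_representation C N n),
    mx_irreducible rN /\ theta = repr_char rN.
Proof.
rewrite mem_undup; split=> [/imageP[i _ ->] | [n [rN [irrN ->]]]].
  by exists _, (irr_repr i); split=> //; apply: socle_irr.
apply/imageP; exists (irr_comp (DecSocleType (regular_repr C N)) rN) => //.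
apply/repr_char_sim/rsim_irr_comp_pchar => //.
by apply: sub_in_pnat (pnat_pi (cardG_gt0 N)) => p _ _; rewrite inE /= pchar_num.
Qed.

Lemma MinP G N chi :
  chi \in Min G N <-> exists2 theta, theta \in Irr N & chi = hat G theta.
Proof. by rewrite mem_undup; split=> [/mapP|?]; last apply/mapP. Qed.

End InvariantCharacters.

(* Main.v *)
(* The irreducible characters are free, since the central idempotents of the
   group ring separate them, and they span the class functions of N, since there
   are as many of them as classes.  G permutes Irr(N), and the sums of its orbits
   are the elements of Min_G(N); by freeness, a class function is G-invariant iff
   its coefficients on Irr(N) are constant on orbits, so the a_t are exactly these
   orbit values.  Characters are the combinations with natural coefficients. *)
Require Import Defs.
From mathcomp Require Import all_boot all_order all_algebra all_fingroup.
From mathcomp Require Import pgroup mxrepresentation character.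
From mathcomp Require Import reals complex.
Import GRing.Theory Num.Theory.
Local Open Scope ring_scope.

(** * Linear independence of the irreducible characters of [N] *)

Section IrreducibleCharacters.

Set Implicit Arguments.
Unset Strict Implicit.

Variables (R : realType) (gT : finGroupType) (N : {group gT}).
Local Notation C := (R[i]).
Local Notation cfunT := {ffun gT -> C}.
Local Notation sN := (DecSocleType (regular_repr C N)).
Local Notation chi_ i := (repr_char (@irr_repr _ _ _ sN i)).

Lemma scale_ffunE (a : C) (f : cfunT) x : (a *: f) x = a * f x.
Proof. by rewrite ffunE. Qed.

Lemma pchar_complex' : ([pchar C]^'.-group N)%g.
Proof.
by apply: sub_in_pnat (pnat_pi (cardG_gt0 N)) => p _ _; rewrite inE /= pchar_num.
Qed.

(** Traces extend linearly from [N] to its group ring, so a linear relation between characters may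
    be evaluated at any group ring element. *)
Lemma mxtrace_gring_op n (rN : mx_representation C N n) A :
  \tr (gring_op rN A)
    = \sum_(i < #|N|) gring_row A 0 i * repr_char rN (enum_val i).
Proof.
rewrite gring_opE [gring_row A in LHS]row_sum_delta !linear_sum.
apply: eq_bigr => i _; rewrite /= !linearZ ffunE enum_valP /=.
by congr (_ * \tr _); rewrite /gring_mx /= -rowE rowK mxvecK.
Qed.

(* Apply the linear relation, extended to the group ring, to the central
   idempotent of the j-th Wedderburn component. *)
Lemma irr_repr_char_free (c : sN -> C) :
  \sum_i c i *: chi_ i = 0 -> forall j, c j = 0.
Proof.
move=> c0 j; have N'C := pchar_complex'.
pose e := @Wedderburn_id _ _ _ sN j.
have: \sum_i c i * \tr (gring_op (irr_repr i) e) = 0.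
  under eq_bigr => i _ do rewrite mxtrace_gring_op mulr_sumr.
  rewrite exchange_big big1 //= => k _.
  under eq_bigr => i _ do rewrite mulrCA -scale_ffunE.
  by rewrite -mulr_sumr -sum_ffunE c0 ffunE mulr0.
rewrite (bigD1 j) //= big1 ?addr0 => [|i ne_ij]; last first.
  rewrite (irr_repr'_op0_pchar N'C _ (Wedderburn_id_mem _)) ?linear0 ?mulr0 //.
  by rewrite eq_sym.
rewrite op_Wedderburn_id_pchar // mxtrace1 => /eqP.
by rewrite mulf_eq0 pnatr_eq0 -leqn0 leqNgt irr_degree_gt0 orbF => /eqP.
Qed.

Lemma irr_repr_char_inj : injective (fun i : sN => chi_ i).
Proof.
move=> i j eq_ij; apply/eqP/idPn => ne_ij.
(* A repeated character would give this nontrivial linear relation. *)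
have: \sum_k ((k == i)%:R - (k == j)%:R) *: chi_ k = 0.
  under eq_bigr => k _ do rewrite scalerBl.
  rewrite sumrB (bigD1 i) //= big1 => [|k /negPf->]; last by rewrite scale0r.
  rewrite (bigD1 j) //= big1 => [|k /negPf->]; last by rewrite scale0r.
  by rewrite !eqxx !scale1r !addr0 eq_ij subrr.
move/irr_repr_char_free/(_ i)/eqP.
by rewrite eqxx (negPf ne_ij) subr0 oner_eq0.
Qed.

Lemma big_Irr (F : cfunT -> cfunT) :
  \sum_(chi <- Irr R N) F chi = \sum_(i : sN) F (chi_ i).
Proof.
rewrite /Irr undup_id ?big_image //.
by rewrite map_inj_uniq ?enum_uniq //; apply: irr_repr_char_inj.
Qed.

Lemma Irr_coef_eq (b c : cfunT -> C) :
    \sum_(chi <- Irr R N) b chi *: chi = \sum_(chi <- Irr R N) c chi *: chi ->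
  {in Irr R N, b =1 c}.
Proof.
rewrite !big_Irr => /eqP; rewrite -subr_eq0 -sumrB => /eqP bc0 chi.
rewrite mem_undup => /imageP[i _ ->].
apply/eqP; rewrite -subr_eq0; apply/eqP.
apply: (@irr_repr_char_free (fun i => b (chi_ i) - c (chi_ i))).
by rewrite -[RHS]bc0; apply: eq_bigr => k _; rewrite scalerBl.
Qed.

(** * Expansion of class functions and characters of [N] in irreducible characters *)

Lemma repr_charJ n (rN : mx_representation C N n) x y :
  x \in N -> y \in N -> repr_char rN (x ^ y)%g = repr_char rN x.
Proof.
move=> Nx Ny; rewrite !ffunE groupJ // Nx.
by rewrite conjgE !repr_mxM ?groupM ?groupV // mxtrace_mulC repr_mxK.
Qed.

Lemma cf_inv_repr_char n (rN : mx_representation C N n) :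
  cf_inv N N (repr_char rN).
Proof.
split=> [x /negPf N'x | x y Nx Ny]; first by rewrite ffunE N'x.
exact: repr_charJ.
Qed.

Lemma cf_inv_ext (f1 f2 : cfunT) : cf_inv N N f1 -> cf_inv N N f2 ->
  (forall xN, xN \in classes N -> f1 (repr xN) = f2 (repr xN)) -> f1 = f2.
Proof.
move=> [f1_0 f1J] [f2_0 f2J] eq_f; apply/ffunP=> x.
have [Nx | N'x] := boolP (x \in N); last by rewrite f1_0 ?f2_0.
have [y Ny def_y] := repr_class N x.
by have:= eq_f _ (mem_classes Nx); rewrite def_y f1J ?f2J.
Qed.

(* The character table is square because the number of irreducible
   representations equals the number of classes; its rows are free. *)
Lemma Irr_span (f : cfunT) : cf_inv N N f ->
  exists c : cfunT -> C, f = \sum_(chi <- Irr R N) c chi *: chi.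
Proof.
move=> cf_f; pose w (j : 'I_#|classes N|) := repr (enum_val j).
pose X := \matrix_(i < #|sN|, j < #|classes N|)
  chi_ (enum_val i) (w j).
have cf_sum (c : sN -> C) : cf_inv N N (\sum_i c i *: chi_ i).
  split=> [x N'x | x y Nx Ny]; rewrite !sum_ffunE.
    by apply: big1 => i _; rewrite scale_ffunE (cf_inv_repr_char _).1 ?mulr0.
  by apply: eq_bigr => i _; rewrite !scale_ffunE repr_charJ.
have sumX (v : 'rV_#|sN|) j :
  (v *m X) 0 j = (\sum_i v 0 (enum_rank i) *: chi_ i) (w j).
  rewrite mxE sum_ffunE (reindex (@enum_rank sN)) /=; last first.
    exact/onW_bij/enum_rank_bij.
  by apply: eq_bigr => i _; rewrite scale_ffunE mxE enum_rankK.
have eq_classes (f1 f2 : cfunT) : cf_inv N N f1 -> cf_inv N N f2 ->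
  (forall j, f1 (w j) = f2 (w j)) -> f1 = f2.
  move=> cf1 cf2 eq12; apply: cf_inv_ext => // xN NxN.
  by have:= eq12 (enum_rank_in NxN xN); rewrite /w enum_rankK_in.
have freeX : row_free X.
  apply: inj_row_free => v vX0; apply/rowP=> i; rewrite mxE.
  rewrite -(enum_valK i); apply: (@irr_repr_char_free (fun i => v 0 (enum_rank i))).
  apply: eq_classes => [||j]; first exact: cf_sum.
    by split=> *; rewrite !ffunE.
  by rewrite -sumX vX0 mxE ffunE.
have fullX : row_full X.
  rewrite /row_full (eqP freeX) card_irr_pchar ?pchar_complex' //.
  (* The count of irreducibles requires a splitting field; [C] is algebraically closed. *)
  exact: group_closure_closed_field.
have /submxP[v def_v]: (\row_j f (w j) <= X)%MS by apply: submx_full.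
(* Coefficients are indexed by characters, so [pick] inverts the injective map [i |-> chi_ i]. *)
pose c chi := if [pick i : sN | chi_ i == chi] is Some i
              then v 0 (enum_rank i) else 0.
exists c; rewrite big_Irr; apply: eq_classes => // j.
have:= congr1 (fun u : 'rV_ _ => u 0 j) def_v; rewrite mxE sumX => ->.
rewrite !sum_ffunE; apply: eq_bigr => i _; rewrite !scale_ffunE; congr (_ * _).
by rewrite /c; case: pickP => [k /eqP/irr_repr_char_inj-> // | /(_ i)/eqP].
Qed.

(** Strong induction on the degree: a simple submodule [U] contributes one irreducible character,
    the quotient by [U] has smaller degree, and the trace is additive over the two. *)
Lemma repr_char_Irr_sum n (rN : mx_representation C N n) :
  exists m : cfunT -> nat,
    repr_char rN = \sum_(chi <- Irr R N) (m chi)%:R *: chi.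
Proof.
have [k] := ubnP n; elim: k => // k IHk in n rN *; rewrite ltnS => le_nk.
have [n0 | n_gt0] := posnP n.
  exists (fun=> 0); rewrite big1 => [|chi _]; last by rewrite scale0r.
  apply/ffunP=> x; rewrite !ffunE; case: ifP => // _.
  by apply: big1 => i; have:= ltn_ord i; rewrite {2}n0.
have nz1 : 1%:M != 0 :> 'M[C]_n by rewrite -mxrank_eq0 mxrank1 -lt0n.
have [U simU _] := dec_mxsimple_exists (mxmodule1 rN) nz1.
have [modU nzU _] := simU.
have [|m def_m] := IHk _ (factmod_repr modU).
  rewrite mxrank_coker (leq_trans _ le_nk) // ltn_subrL n_gt0 lt0n.
  by rewrite mxrank_eq0 nzU.
pose theta := repr_char (submod_repr modU).
have Irr_theta : theta \in Irr R N.
  by apply/IrrP; exists _, (submod_repr modU); split=> //; apply/submod_mx_irr.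
exists (fun chi => (chi == theta) + m chi)%N.
under eq_bigr => chi _ do rewrite natrD scalerDl.
rewrite big_split /= -def_m (bigD1_seq theta) ?undup_uniq //= eqxx scale1r.
rewrite big1 => [|chi /negPf->]; last by rewrite scale0r.
apply/ffunP=> x; rewrite addr0 !ffunE -(mxtrace_sub_fact_mod modU).
by case: ifP => // _; rewrite addr0.
Qed.

(** Block-diagonal sums realise addition, and the representation of degree 0 realises the empty sum;
    hence [n] may be 0 here. *)
Lemma Irr_sum_repr_char (m : cfunT -> nat) :
  exists n (rN : mx_representation C N n),
    \sum_(chi <- Irr R N) (m chi)%:R *: chi = repr_char rN.
Proof.
pose P f := exists n (rN : mx_representation C N n), f = repr_char rN.
have P0 : P 0.
  exists _, (grepr0 : representation C N); apply/ffunP=> x.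
  by rewrite !ffunE mxtrace1 if_same.
have PD f1 f2 : P f1 -> P f2 -> P (f1 + f2).
  move=> [n1 [r1 ->]] [n2 [r2 ->]].
  exists _, (dadd_grepr (Representation r1) (Representation r2)).
  apply/ffunP=> x; rewrite !ffunE mxtrace_block.
  by case: ifP; rewrite ?addr0.
rewrite big_seq; apply: (big_ind P) => // chi /IrrP[n [rN [_ ->]]].
elim: (m _) => [|k IHk]; first by rewrite scale0r.
by rewrite -natr1 scalerDl scale1r; apply: PD => //; exists n, rN.
Qed.

End IrreducibleCharacters.

(** * The action of [G] on [Irr R N] and its orbit sums *)

Section InvariantCharacters.

Set Implicit Arguments.
Unset Strict Implicit.

Variables (R : realType) (gT : finGroupType) (G N : {group gT}).
Hypothesis nNG : (N <| G)%g.
Local Notation C := (R[i]).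
Local Notation cfunT := {ffun gT -> C}.
Implicit Types (f theta chi : cfunT).

Lemma conj_funE f g x : conj_fun f g x = f (x ^ g^-1)%g.
Proof. by rewrite ffunE conjgE invgK mulgA. Qed.

Lemma conj_funM f g h : conj_fun (conj_fun f g) h = conj_fun f (g * h)%g.
Proof. by apply/ffunP=> x; rewrite !ffunE invMg !mulgA. Qed.

Lemma conj_fun1 f : conj_fun f 1 = f.
Proof. by apply/ffunP=> x; rewrite ffunE mul1g invg1 mulg1. Qed.

Lemma conj_fun_sum (I : Type) (r : seq I) (c : I -> C) (F : I -> cfunT) g :
  conj_fun (\sum_(i <- r) c i *: F i) g = \sum_(i <- r) c i *: conj_fun (F i) g.
Proof.
apply/ffunP=> x; rewrite ffunE !sum_ffunE.
by apply: eq_bigr => i _; rewrite !scale_ffunE ffunE.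
Qed.

Lemma cf_inv_conj f : cf_inv G N f -> forall g, g \in G -> conj_fun f g = f.
Proof.
move=> [f0 fJ] g Gg; apply/ffunP=> x; rewrite conj_funE.
have [Nx | N'x] := boolP (x \in N); first by rewrite fJ ?groupV.
by rewrite !f0 // memJ_norm // groupV (subsetP (normal_norm nNG)).
Qed.

(** Precomposing a representation with conjugation by [g^-1], an automorphism of the normal subgroup
    [N], leaves the set of acting matrices unchanged, hence also the invariant subspaces. *)
Lemma conj_fun_Irr theta g :
  theta \in Irr R N -> g \in G -> conj_fun theta g \in Irr R N.
Proof.
move=> /IrrP[n [rN [irrN ->]]] Gg.
have nNg x : (x ^ g^-1 \in N)%g = (x \in N).
  by rewrite memJ_norm // groupV (subsetP (normal_norm nNG)).
have rgP : mx_repr N (fun x => rN (x ^ g^-1)%g).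
  by split=> [|x y Nx Ny]; rewrite ?conj1g ?repr_mx1 // conjMg repr_mxM ?nNg.
apply/IrrP; exists n, (MxRepresentation rgP); split; last first.
  by apply/ffunP=> x; rewrite conj_funE !ffunE nNg.
have [_ nz1 simN] := irrN; split=> // [|U modU _ nzU]; first exact: mxmodule1.
apply: simN => //; rewrite ?submx1 //; apply/mxmoduleP=> x Nx.
have := mxmoduleP modU (x ^ g)%g; rewrite /= conjgK; apply.
by rewrite -nNg conjgK.
Qed.

Lemma conjugatesP theta chi :
  reflect (exists2 g, g \in G & chi = conj_fun theta g)
          (chi \in Defs.conjugates G theta).
Proof. by rewrite mem_undup; apply: imageP. Qed.

Lemma hat_conj theta g : g \in G -> hat G (conj_fun theta g) = hat G theta.
Proof.
move=> Gg; apply: perm_big; apply: uniq_perm; rewrite ?undup_uniq // => chi.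
apply/conjugatesP/conjugatesP => -[h Gh ->].
  by exists (g * h)%g; rewrite ?groupM ?conj_funM.
by exists (g^-1 * h)%g; rewrite ?groupM ?groupV // conj_funM mulKVg.
Qed.

(** Writes an orbit sum with the indicator of the orbit as coefficients, so that freeness applies to
    it. *)
Lemma hat_Irr_sum theta : theta \in Irr R N ->
  hat G theta = \sum_(chi <- Irr R N) (chi \in Defs.conjugates G theta)%:R *: chi.
Proof.
move=> Irr_theta; under eq_bigr => chi _ do
  (rewrite scaler_nat mulrb; over).
rewrite -big_mkcond -big_filter; apply: perm_big.
apply: uniq_perm; rewrite ?filter_uniq ?undup_uniq // => chi.
rewrite mem_filter; case: conjugatesP => // -[g Gg ->].
by rewrite conj_fun_Irr.
Qed.

(** By freeness an orbit sum determines its orbit: compare the coefficients at [chi]. *)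
Lemma eq_hat theta chi : theta \in Irr R N -> chi \in Irr R N ->
  (hat G chi == hat G theta) = (chi \in Defs.conjugates G theta).
Proof.
move=> Itheta Ichi; apply/eqP/idP => [eq_hat | /conjugatesP[g Gg ->]].
  2: exact: hat_conj.
have chi_chi : chi \in Defs.conjugates G chi.
  by apply/conjugatesP; exists 1%g; rewrite ?conj_fun1.
move: eq_hat; rewrite !hat_Irr_sum // => /Irr_coef_eq/(_ chi Ichi)/eqP.
by rewrite chi_chi eqr_nat; case: (chi \in _).
Qed.

(** Each [chi] occurs in exactly one orbit sum, namely [hat G chi], so the double sum collapses. The
    default 0 is never reached for [chi] in [Irr R N]. *)
Lemma Min_sum (a : seq_sub (Min R G N) -> C) :
  \sum_t a t *: val t =
  \sum_(chi <- Irr R N) oapp a 0 (insub (hat G chi)) *: chi.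
Proof.
have val_sum (t : seq_sub (Min R G N)) :
  val t = \sum_(chi <- Irr R N) (hat G chi == val t)%:R *: chi.
  have /MinP[theta Itheta ->] := valP t; rewrite [LHS]hat_Irr_sum // !big_seq.
  by apply: eq_bigr => chi Ichi; rewrite eq_hat.
under eq_bigr => t _ do rewrite val_sum scaler_sumr.
rewrite exchange_big /= !big_seq; apply: eq_bigr => chi Ichi.
have Mchi : hat G chi \in Min R G N by apply/MinP; exists chi.
have -> : insub (hat G chi) = Some (SeqSub Mchi) by apply: insubT.
rewrite /= (bigD1 (SeqSub Mchi)) //=.
rewrite eqxx scale1r big1 ?addr0 // => t; rewrite -val_eqE eq_sym /=.
by move=> /negPf->; rewrite scale0r scaler0.
Qed.

(** Conjugation by [g^-1] fixes [f] and permutes [Irr R N]; reindexing gives a second expansion of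
    [f], and freeness equates the two. *)
Lemma invariant_Irr_coef f (c : cfunT -> C) :
    f = \sum_(chi <- Irr R N) c chi *: chi ->
    (forall g, g \in G -> conj_fun f g = f) ->
  {in Irr R N & G, forall chi g, c (conj_fun chi g) = c chi}.
Proof.
move=> def_f fG chi g Ichi Gg.
suff /Irr_coef_eq/(_ chi Ichi) :
  \sum_(chi <- Irr R N) c (conj_fun chi g) *: chi =
    \sum_(chi <- Irr R N) c chi *: chi by [].
rewrite -def_f -[RHS](fG _ (groupVr Gg)) def_f conj_fun_sum.
have permI : perm_eq (Irr R N) [seq conj_fun chi g^-1%g | chi <- Irr R N].
  have conjK : cancel (@conj_fun R gT ^~ g^-1%g) (@conj_fun R gT ^~ g).
    by move=> psi; rewrite conj_funM mulVg conj_fun1.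
  apply: uniq_perm => [||psi]; first exact: undup_uniq.
    by rewrite (map_inj_uniq (can_inj conjK)) undup_uniq.
  apply/idP/mapP => [Ipsi | [eta Ieta ->]]; last first.
    by rewrite conj_fun_Irr ?groupV.
  exists (conj_fun psi g); first exact: conj_fun_Irr.
  by rewrite conj_funM mulgV conj_fun1.
rewrite (perm_big _ permI) big_map; apply: eq_bigr => psi _.
by rewrite conj_funM mulVg conj_fun1.
Qed.

Lemma Min_span f : cf_inv G N f ->
  exists a : {ffun seq_sub (Min R G N) -> C}, f = \sum_t a t *: val t.
Proof.
move=> cf_f; have [f0 fJ] := cf_f.
have [|c def_f] := @Irr_span R gT N f.
  by split=> // x y Nx Ny; rewrite fJ // (subsetP (normal_sub nNG)).
have cG := invariant_Irr_coef def_f (cf_inv_conj cf_f).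
have hatP (t : seq_sub (Min R G N)) :
  exists2 theta, theta \in Irr R N & val t = hat G theta.
  by apply/MinP/valP.
(* Any representative of the orbit will do, since [c] is constant on orbits by [cG]. *)
pose rep t := s2val (sig2_eqW (hatP t)).
exists [ffun t => c (rep t)]; rewrite Min_sum def_f !big_seq.
apply: eq_bigr => chi Ichi.
have Mchi : hat G chi \in Min R G N by apply/MinP; exists chi.
have -> : insub (hat G chi) = Some (SeqSub Mchi) by apply: insubT.
rewrite /= ffunE /rep.
case: sig2_eqW => theta Itheta /= /eqP.
by rewrite eq_hat // => /conjugatesP[g Gg ->]; rewrite cG.
Qed.

(** Serves both uniqueness, with [c] read off a second expansion over [Min R G N], and integrality,
    with [c] the multiplicities in a representation. *)
Lemma Min_coef_eq (a : {ffun seq_sub (Min R G N) -> C}) (c : cfunT -> C) :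
    \sum_t a t *: val t = \sum_(chi <- Irr R N) c chi *: chi ->
  forall t,
    exists2 theta, theta \in Irr R N /\ val t = hat G theta & a t = c theta.
Proof.
rewrite Min_sum => /Irr_coef_eq eq_ac t.
have /MinP[theta Itheta def_t] := valP t; exists theta => //.
by rewrite -eq_ac // -def_t valK.
Qed.

End InvariantCharacters.

Theorem proposition5p2 (R : realType) (gT : finGroupType) (G N : {group gT})
    (nNG : (N <| G)%g) (f : {ffun gT -> R[i]}) (hf : cf_inv G N f) :
  (exists! a : {ffun seq_sub (Min R G N) -> R[i]},
     f = \sum_(t : seq_sub (Min R G N)) a t *: val t) /\
  (forall a : {ffun seq_sub (Min R G N) -> R[i]},
     f = \sum_(t : seq_sub (Min R G N)) a t *: val t ->
     (is_inv_character G N f <->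
      (forall t : seq_sub (Min R G N), exists m : nat, a t = m%:R) /\ f <> 0)).
Proof.
split=> [|a def_f].
  have [a def_f] := Min_span nNG hf; exists a; split=> // b.
  rewrite def_f (Min_sum nNG b) => /(Min_coef_eq nNG) ab.
  apply/ffunP=> t; have [theta [_ def_t] ->] := ab t.
  by rewrite -def_t valK.
split=> [[[n [n_gt0 [rN def_rN]]] _] | [a_nat nz_f]].
  split=> [t | f0]; last first.
    (* The value at 1 is the degree, which is positive. *)
    have:= congr1 (fun h : {ffun gT -> R[i]} => h 1%g) f0.
    rewrite def_rN !ffunE group1 repr_mx1 mxtrace1 => /eqP.
    by rewrite pnatr_eq0 -leqn0 leqNgt n_gt0.
  have [m def_m] := repr_char_Irr_sum rN.
  move: def_m; rewrite -def_rN def_f => /(Min_coef_eq nNG)/(_ t)[theta _ ->].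
  by exists (m theta).
split; last exact: cf_inv_conj nNG _ hf.
have /fin_all_exists[k def_k] := a_nat.
(* The multiplicity of [chi] is that of its orbit sum; the default 0 matches the one in
   [Min_sum]. *)
pose m chi := oapp k 0%N (insub (hat G chi)).
have [n [rN def_rN]] := @Irr_sum_repr_char R gT N m.
exists n; have {}def_rN : f = repr_char rN.
  rewrite -def_rN def_f (Min_sum nNG); apply: eq_bigr => chi _.
  rewrite /m; case: insubP => [t _ _|_] //=.
  by rewrite def_k.
split; last by exists rN.
(* A representation of degree 0 has zero trace, against [f <> 0]. *)
rewrite lt0n; apply/eqP=> n0; case: nz_f; rewrite def_rN.
apply/ffunP=> x; rewrite !ffunE; case: ifP => // _.
by apply: big1 => i; have:= ltn_ord i; rewrite {2}n0.
Qed.
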